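(* Let $G$ be a finite graph and let $u$ and $v$ be vertices of $G$. In the vertex cover toggle group $T(\mathcal{VC}(G))$, $(t_ut_v)^2=1$ if and only if there is no edge between $u$ and $v$.
   Context: A vertex cover of a graph $G$ is a subset of the vertices such that every edge of $G$ is incident to at least one vertex in the subset; $\mathcal{VC}(G)\subseteq 2^{V(G)}$ is the set of vertex covers. For $v\in V(G)$ the toggle $t_v:\mathcal{VC}(G)\to\mathcal{VC}(G)$ is given by $t_v(X)=X\cup\{v\}$ if $v\notin X$ and $X\cup\{v\}\in\mathcal{VC}(G)$; $t_v(X)=X\setminus\{v\}$ if $v\in X$ and $X\setminus\{v\}\in\mathcal{VC}(G)$; and $t_v(X)=X$ otherwise. $T(\mathcal{VC}(G))$ is the subgroup of the symmetric group on $\mathcal{VC}(G)$ generated by all $t_v$, $v\in V(G)$. *)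

(* Defs.v *)
From HB Require Import structures.
From mathcomp Require Import all_boot all_fingroup.

Set Implicit Arguments.
Unset Strict Implicit.
Unset Printing Implicit Defensive.

Record sgraph := SGraph {
  vertex :> finType;
  adj : rel vertex;
  adj_sym : symmetric adj;
  adj_irrefl : irreflexive adj }.

Section ToggleGroup.
Variable G : sgraph.
Implicit Types (v : G) (X : {set G}).

Definition vertex_cover X : bool :=
  [forall x, forall y, adj x y ==> (x \in X) || (y \in X)].

Record VC := MkVC { cover_set :> {set G}; _ : vertex_cover cover_set }.
HB.instance Definition _ := [isSub for cover_set].
HB.instance Definition _ := [Finite of VC by <:].

Definition toggle_set v X : {set G} :=
  if (v \notin X) && vertex_cover (v |: X) then v |: X
  else if (v \in X) && vertex_cover (X :\ v) then X :\ v
  else X.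

Lemma toggle_set_cover v X : vertex_cover X -> vertex_cover (toggle_set v X).
Proof. by rewrite /toggle_set => cX; case: ifP => [/andP[]|_] //; case: ifP => [/andP[]|]. Qed.

Definition toggle v (C : VC) : VC :=
  MkVC (toggle_set_cover v (valP C)).

Lemma toggleK v : involutive (toggle v).
Proof.
move=> [X cX]; apply: val_inj; rewrite /= /toggle_set.
case vX: (v \in X) => /=.
  case cD: (vertex_cover (X :\ v)) => /=; last by rewrite vX /= cD.
  by rewrite setD11 /= setD1K // cX.
case cU: (vertex_cover (v |: X)) => /=; last by rewrite vX /= cU.
by rewrite setU11 /= setU1K ?vX // cX.
Qed.

Definition toggle_perm v : {perm VC} := perm (can_inj (toggleK v)).

Definition toggle_group : {group {perm VC}} :=
  <<[set toggle_perm v | v : G]>>%G.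

Lemma toggle_perm_in v : toggle_perm v \in toggle_group.
Proof. by rewrite mem_gen // imset_f. Qed.

(* The toggle as an element of the toggle group itself, not only of {perm VC}. *)
Definition tog v : [subg toggle_group] := Subg (toggle_perm_in v).

End ToggleGroup.

(* Main.v *)
Require Import Defs.
From mathcomp Require Import all_boot all_fingroup.

(* On a vertex cover X, the toggle at v flips the membership of v exactly when
   all neighbours of v lie in X.  If u <> v are not adjacent, toggling at u
   changes neither v nor a neighbour of v, so the two toggles commute.  If u and
   v are adjacent, starting from the full cover V, the toggles at u, v, u, v lead
   to V \ u, V \ u, V and V \ v. *)

Local Open Scope group_scope.

(** One condition serves both directions: on a cover it is what removing [v] requires, and it holds
    by itself when [v] is absent. *)
Definition toggleable {G : sgraph} (v : G) (X : {set G}) : bool :=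
  [forall y, adj v y ==> (y \in X)].

Lemma vertex_coverP {G : sgraph} (X : {set G}) :
  reflect (forall x y, adj x y -> (x \in X) || (y \in X)) (vertex_cover X).
Proof.
apply: (iffP forallP) => [cX x y xy | cX x].
  by move/forallP/(_ y)/implyP: (cX x); apply.
by apply/forallP => y; apply/implyP/cX.
Qed.

Lemma vertex_coverS {G : sgraph} (X Y : {set G}) :
  X \subset Y -> vertex_cover X -> vertex_cover Y.
Proof.
move=> /subsetP sXY /vertex_coverP cX; apply/vertex_coverP => x y /cX.
by case/orP => /sXY ->; rewrite ?orbT.
Qed.

Lemma toggleable_notin {G : sgraph} (v : G) (X : {set G}) :
  vertex_cover X -> v \notin X -> toggleable v X.
Proof.
move=> /vertex_coverP cX vX; apply/forallP => y; apply/implyP => /cX.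
by rewrite (negPf vX).
Qed.

(** Only edges at [v] can become uncovered; as there are no loops, their other endpoint is not
    [v]. *)
Lemma vertex_coverD1 {G : sgraph} (v : G) (X : {set G}) :
  vertex_cover X -> vertex_cover (X :\ v) = toggleable v X.
Proof.
move=> /vertex_coverP cX; apply/vertex_coverP/forallP => [cD y | tv x y xy].
  apply/implyP => /cD; rewrite !inE eqxx /=.
  by case/andP.
rewrite !inE; have := cX _ _ xy.
have [xv | _] := eqVneq x v; have [yv | _] //= := eqVneq y v.
- by move: xy; rewrite xv yv adj_irrefl.
- by move=> _; move/implyP: (tv y); apply; rewrite -xv.
- by move=> _; rewrite orbF; move/implyP: (tv x); apply; rewrite -yv adj_sym.
Qed.

(** The exclusive-or form reduces commutation of toggles to reordering a sum of booleans. *)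
Lemma in_toggle {G : sgraph} (v w : G) (C : VC G) :
  (w \in (toggle v C : {set G})) = (w \in (C : {set G})) (+) ((w == v) && toggleable v C).
Proof.
have cC : vertex_cover C := valP C.
rewrite /= /toggle_set vertex_coverD1 // (vertex_coverS _ _ (subsetUr _ _)) // andbT.
have [vC | vC] /= := boolP (v \in _).
  by case: ifP; rewrite ?inE; have [-> | ] := eqVneq w v; rewrite ?vC ?addbF.
rewrite !inE toggleable_notin // andbT.
by have [-> | ] := eqVneq w v; rewrite ?(negPf vC) ?addbF.
Qed.

(** Only the membership of [v] can change, and [v] is not a neighbour of [u]; this includes
    [u = v]. *)
Lemma toggleable_toggle {G : sgraph} (u v : G) (C : VC G) :
  ~~ adj u v -> toggleable u (toggle v C) = toggleable u C.
Proof.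
move=> uv; apply: eq_forallb => y; rewrite in_toggle.
by have [-> | _] := eqVneq y v; rewrite ?(negPf uv) ?addbF.
Qed.

Lemma toggleC {G : sgraph} (u v : G) (C : VC G) :
  ~~ adj u v -> toggle u (toggle v C) = toggle v (toggle u C).
Proof.
move=> uv; apply/val_inj/setP => w; change val with (@cover_set G).
have vu : ~~ adj v u by rewrite adj_sym.
rewrite !in_toggle !toggleable_toggle //.
exact: addbAC.
Qed.

Lemma vertex_coverT (G : sgraph) : vertex_cover [set: G].
Proof. by apply/vertex_coverP => x y _; rewrite inE. Qed.

Lemma toggleable_coverT {G : sgraph} (v : G) : toggleable v [set: G].
Proof. by apply/forallP => y; rewrite inE implybT. Qed.

Lemma toggle_adj_coverT {G : sgraph} (u v : G) :
  let V := MkVC (vertex_coverT G) in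
  adj u v -> toggle v (toggle u V) = toggle u V.
Proof.
move=> V uv; apply/val_inj/setP => w; change val with (@cover_set G).
(* The toggle at [v] is blocked: its neighbour [u] is missing from [toggle u V]. *)
rewrite [LHS]in_toggle [X in _ && X](_ : _ = false) ?andbF ?addbF //.
apply/negP => /forallP/(_ u).
by rewrite adj_sym uv in_toggle eqxx toggleable_coverT inE.
Qed.

(** Permutations compose from left to right, so the toggle at [u] acts first. *)
Lemma tog_sqr_eq1 {G : sgraph} (u v : G) :
  (tog u * tog v) ^+ 2 = 1 <->
  forall C : VC G, toggle v (toggle u (toggle v (toggle u C))) = C.
Proof.
apply: (@iff_trans _ ((toggle_perm u * toggle_perm v) ^+ 2 = 1)).
  split=> [E | E]; last exact: val_inj.
  exact: (congr1 val E).
rewrite expgS expg1; split=> [/permP E C | E].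
  by have := E C; rewrite !permM perm1 !permE.
by apply/permP => C; rewrite !permM perm1 !permE.
Qed.

Theorem lemma3p26 (G : sgraph) (u v : G) :
  (tog u * tog v) ^+ 2 = 1 <-> ~~ adj u v.
Proof.
apply: (iff_trans (tog_sqr_eq1 u v)); split=> [E | uv C]; last first.
  (* Swapping the middle two toggles makes equal ones adjacent, and they cancel. *)
  by rewrite (toggleC _ _ _ uv) !toggleK.
apply/negP => uv; pose V := MkVC (vertex_coverT G).
have /(congr1 (fun C : VC G => v \in (C : {set G}))) := E V.
(* The four toggles reduce to [toggle v V], which lacks [v], while [V] contains it. *)
rewrite toggle_adj_coverT // toggleK in_toggle eqxx toggleable_coverT.
by rewrite inE.
Qed.
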